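(* Let $p$ be a prime, let $r\in\mathbb{Z}^+$, let $1 \le v_1 \le \ldots \le v_r$ be integers, and let $G = \bigoplus_{j=1}^r \mathbb{Z}/p^{v_j}\mathbb{Z}$. Let $\{A_i\}_{i=1}^\infty$ be a sequence of subsets of $\mathbb{Z}/p^{v_r}\mathbb{Z}$, and for $1 \le j \le r$ let $B_j \subset \mathbb{Z}/p^{v_j}\mathbb{Z}$. Suppose each $A_i$ and each $B_j$ is nonempty and has no two distinct elements congruent modulo $p$. Let $B = \prod_{j=1}^r B_j \subset G$. Let $n\in\mathbb{Z}^+$ and let $\underline{g} = \{g_i\}_{i=1}^n$ be a sequence in $G$. (a) The number of $(a_1,\ldots,a_n) \in \prod_{i=1}^n A_i$ with $\sum_{i=1}^n a_i g_i \in B$ is $0$ or at least $$\mathfrak{m}\Big(\# A_1,\ldots,\# A_n;\ \sum_{i=1}^n \# A_i - \sum_{j=1}^r (p^{v_j}-\# B_j)\Big).$$ (b) If $0$ lies in each $A_i$ and in each $B_j$, and $$\sum_{i=1}^n (\# A_i - 1) > \sum_{j=1}^r (p^{v_j}-\# B_j),$$ then there is $(a_1,\ldots,a_n) \in \prod_{i=1}^n A_i$, not all $a_i$ equal to $0$, with $\sum_{i=1}^n a_i g_i \in B$.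
   Context: The group $G$ is regarded as a module over $\mathbb{Z}/p^{v_r}\mathbb{Z}$, so that $a_i g_i$ makes sense for $a_i \in A_i$. For $n,a_1,\ldots,a_n \in \mathbb{Z}^+$ and an integer $N \le \sum_{i=1}^n a_i$, put $\mathfrak{m}(a_1,\ldots,a_n;N) = 1$ if $N < n$, and, if $n \le N \le \sum_{i=1}^n a_i$, let $\mathfrak{m}(a_1,\ldots,a_n;N)$ be the minimum of $\prod_{i=1}^n y_i$ over all $(y_1,\ldots,y_n) \in \mathbb{Z}^n$ with $1 \le y_i \le a_i$ for all $i$ and $\sum_{i=1}^n y_i = N$. *)

(* Defs.v *)
From HB Require Import structures.
From mathcomp Require Import all_boot all_order all_algebra.

Set Implicit Arguments.
Unset Strict Implicit.
Unset Printing Implicit Defensive.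

Import Order.TTheory GRing.Theory Num.Theory.
Local Open Scope ring_scope.

(* Pitfall: 'Z_m is Z/mZ only for m > 1; below m is always p ^ v j with p prime
   and v j > 0. *)
Definition dsum (p r : nat) (v : 'I_r -> nat) : Type :=
  {dffun forall j : 'I_r, 'Z_(p ^ v j)}.

HB.instance Definition _ (p r : nat) (v : 'I_r -> nat) :=
  Finite.on (dsum p v).

Section DirectSum.
Variables (p r : nat) (v : 'I_r -> nat).
Implicit Types x y z : dsum p v.

Definition dsum_zero : dsum p v := [ffun j => 0 : 'Z_(p ^ v j)].
Definition dsum_opp x : dsum p v := [ffun j => - x j : 'Z_(p ^ v j)].
Definition dsum_add x y : dsum p v := [ffun j => x j + y j : 'Z_(p ^ v j)].

Fact dsum_addA : associative dsum_add.
Proof. by move=> x y z; apply/ffunP=> j; rewrite !ffunE addrA. Qed.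
Fact dsum_addC : commutative dsum_add.
Proof. by move=> x y; apply/ffunP=> j; rewrite !ffunE addrC. Qed.
Fact dsum_add0 : left_id dsum_zero dsum_add.
Proof. by move=> x; apply/ffunP=> j; rewrite !ffunE add0r. Qed.
Fact dsum_addN : left_inverse dsum_zero dsum_opp dsum_add.
Proof. by move=> x; apply/ffunP=> j; rewrite !ffunE addNr. Qed.

HB.instance Definition _ := GRing.isZmodule.Build (dsum p v)
  dsum_addA dsum_addC dsum_add0 dsum_addN.

(* a acts on the j-th factor through its reduction modulo p ^ v j, computed on
   the representative of a in [0, m).  For m = p ^ w with v j <= w for all j,
   this is the Z/mZ-module structure: see the four dscale lemmas below. *)
Definition dscale (m : nat) (a : 'Z_m) x : dsum p v :=
  [ffun j => (a : nat)%:R * x j : 'Z_(p ^ v j)].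

Definition dbox (B : forall j : 'I_r, {set 'Z_(p ^ v j)}) : {set dsum p v} :=
  [set x : dsum p v | [forall j, x j \in B j]].

Lemma dscaleDr m (a : 'Z_m) x y : dscale a (x + y) = dscale a x + dscale a y.
Proof. by apply/ffunP=> j; rewrite !ffunE mulrDr. Qed.

Lemma dscale1 m x : dscale (1 : 'Z_m) x = x.
Proof. by apply/ffunP=> j; rewrite !ffunE mul1r. Qed.

Section ScaleLaws.
Variable w : nat.
Hypotheses (p_pr : prime p) (v_gt0 : forall j, (0 < v j)%N).
Hypothesis v_le : forall j, (v j <= w)%N.

Let natr_mod j k :
  (0 < w)%N -> (k %% (Zp_trunc (p ^ w)).+2)%:R = k%:R :> 'Z_(p ^ v j).
Proof.
have gt1 e : (0 < e)%N -> (1 < p ^ e)%N.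
  by move=> e_gt0; rewrite -(exp1n e) ltn_exp2r ?prime_gt1.
move=> w_gt0; apply: ord_inj; rewrite [X in (k %% X)%N]Zp_cast ?gt1 //.
by rewrite !val_Zp_nat ?gt1 // modn_dvdm // dvdn_exp2l.
Qed.

Lemma dscaleDl (a b : 'Z_(p ^ w)) x : dscale (a + b) x = dscale a x + dscale b x.
Proof.
apply/ffunP=> j; rewrite !ffunE -mulrDl -natrD /= natr_mod //.
exact: leq_trans (v_gt0 j) (v_le j).
Qed.

Lemma dscaleA (a b : 'Z_(p ^ w)) x : dscale a (dscale b x) = dscale (a * b) x.
Proof.
apply/ffunP=> j; rewrite !ffunE mulrA -natrM /= natr_mod //.
exact: leq_trans (v_gt0 j) (v_le j).
Qed.

End ScaleLaws.
End DirectSum.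

Definition incongruent (p m : nat) (S : {set 'Z_m}) : Prop :=
  forall x y : 'Z_m, x \in S -> y \in S -> (x : nat) = y %[mod p] -> x = y.

(* Each product with y i <= a i is at most \prod_i a i, so taking the latter as
   the default of the minimum does not affect the minimum over a nonempty set;
   that set is nonempty exactly when n <= N <= \sum_i a i (the a i being
   positive).  The value for N > \sum_i a i is junk. *)
Definition min_prod (n : nat) (a : 'I_n -> nat) (N : int) : nat :=
  if N < n%:Z then 1%N else
  \big[Order.min/(\prod_(i < n) a i)%N]_(y : {dffun forall i : 'I_n, 'I_(a i).+1} |
      [forall i, (0 < y i)%N] && ((\sum_(i < n) y i)%N%:Z == N))
    (\prod_(i < n) y i)%N.

Lemma min_prod_le n (a y : 'I_n -> nat) :
  (forall i, 0 < y i <= a i)%N ->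
  (min_prod a (\sum_(i < n) y i)%N%:Z <= \prod_(i < n) y i)%N.
Proof.
move=> y_bd; have n_le : (n <= \sum_(i < n) y i)%N.
  rewrite -[leqLHS](card_ord n) -sum1_card leq_sum // => i _.
  by have /andP[] := y_bd i.
rewrite /min_prod ltz_nat ltnNge n_le /=.
pose Y : {dffun forall i : 'I_n, 'I_(a i).+1} := [ffun i => inord (y i)].
have YE i : Y i = y i :> nat.
  by rewrite ffunE inordK // ltnS; have /andP[] := y_bd i.
rewrite -!(eq_bigr _ (fun i _ => YE i)) -leEnat.
apply: (@bigmin_inf _ _ _ _ Y); rewrite // eqxx andbT.
by apply/forallP=> i; rewrite YE; have /andP[] := y_bd i.
Qed.

Lemma min_prod_attained n (a y : 'I_n -> nat) :
  (forall i, 0 < y i <= a i)%N ->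
  exists z : 'I_n -> nat,
    [/\ forall i, (0 < z i <= a i)%N,
        (\sum_(i < n) z i = \sum_(i < n) y i)%N
      & min_prod a (\sum_(i < n) y i)%N%:Z = (\prod_(i < n) z i)%N].
Proof.
move=> y_bd; have n_le : (n <= \sum_(i < n) y i)%N.
  rewrite -[leqLHS](card_ord n) -sum1_card leq_sum // => i _.
  by have /andP[] := y_bd i.
have := min_prod_le y_bd.
rewrite /min_prod ltz_nat ltnNge n_le /=.
pose K k := (k <= \prod_(i < n) y i)%N -> exists z : 'I_n -> nat,
  [/\ forall i, (0 < z i <= a i)%N, (\sum_(i < n) z i = \sum_(i < n) y i)%N
    & k = (\prod_(i < n) z i)%N].
apply: (big_ind K) => [a_le|k l Kk Kl|z /andP[/forallP z_gt0 /eqP[z_sum]] _].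
- exists y; split=> //; apply/eqP; rewrite eqn_leq a_le leq_prod // => i _.
  by have /andP[] := y_bd i.
- by rewrite /K /Order.min; case: ifP.
- by exists (fun i => z i); split=> // i; rewrite z_gt0 -ltnS ltn_ord.
Qed.

(* Main.v *)
(** Fix integer representatives and let L_j(a) be the j-th coordinate of
    sum_i a_i g_i, an integral linear form in a.  The product over j and over
    the c not in B_j of L_j(a) - c is an integer polynomial F of degree
    sum_j (p^(v_j) - #B_j).  Since the elements of B_j are distinct mod p,
    there is a fixed e such that p^e divides F(a) for all a, while p^(e+1)
    does not divide F(a) exactly when a is a solution.  The theorem is then an
    Alon-Furedi bound for the points where F/p^e is nonzero mod p; as the
    elements of A_i are distinct mod p, dividing by their differences preserves
    p-adic valuations, so the inductive proof over a field still works. *)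

Require Import Defs.
From mathcomp Require Import all_boot all_order all_algebra zify ring.

Import Order.TTheory GRing.Theory Num.Theory.
Local Open Scope ring_scope.

(** * Valuations of products and of congruent integers *)

Lemma logn_prod (p : nat) (I : finType) (P : pred I) (f : I -> nat) :
    (forall i, P i -> (0 < f i)%N) ->
  logn p (\prod_(i | P i) f i)%N = (\sum_(i | P i) logn p (f i))%N.
Proof.
move=> f_gt0; have [] // : (0 < \prod_(i | P i) f i)%N /\
  logn p (\prod_(i | P i) f i)%N = (\sum_(i | P i) logn p (f i))%N.
apply: (big_rec2 (fun x s => 0 < x /\ logn p x = s)%N) => [|i s x Pi [x_gt0 <-]].
  by rewrite logn1.
by rewrite muln_gt0 f_gt0 // lognM ?f_gt0.
Qed.

(** Pull [p ^ e i] out of each factor; by Euclid's lemma one more [p] divides the product of the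
    cofactors only if it divides one of them. *)
Lemma dvdz_prod_pfactor (p : nat) (I : finType) (f : I -> int) (e : I -> nat) :
    prime p -> (forall i, ((p ^ e i)%N%:Z %| f i)%Z) ->
  ((p ^ (\sum_i e i))%N%:Z %| \prod_i f i)%Z /\
  ((p ^ (\sum_i e i).+1)%N%:Z %| \prod_i f i)%Z =
    [exists i, ((p ^ (e i).+1)%N%:Z %| f i)%Z].
Proof.
move=> p_pr e_f; rewrite !dvdzE /= (big_morph absz abszM absz1).
pose u i := (`|f i| %/ p ^ e i)%N.
have fE i : `|f i|%N = (p ^ e i * u i)%N.
  by rewrite mulnC divnK //; have := e_f i; rewrite dvdzE.
rewrite (eq_bigr _ (fun i _ => fE i)) big_split /= -expn_sum.
split; first exact: dvdn_mulr.
rewrite expnSr dvdn_pmul2l ?expn_gt0 ?prime_gt0 // Euclid_dvd_prod // big_orE.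
apply: eq_existsb => i; rewrite dvdzE /= fE expnSr.
by rewrite dvdn_pmul2l ?expn_gt0 ?prime_gt0.
Qed.

(** Modulo [p ^ v] one sees divisibility by each [p ^ i] with [i <= v], and this determines a
    valuation below [v]. *)
Lemma logn_eqmod (p v k : nat) (x : int) : prime p -> ~~ (p ^ v %| k)%N ->
  ((p ^ v)%N%:Z %| x - k%:Z)%Z -> logn p `|x| = logn p k.
Proof.
move=> p_pr v_k v_xk.
have dvdE i : (i <= v)%N -> (p ^ i %| `|x|)%N = (p ^ i %| k)%N.
  move=> iv; suff: ((p ^ i)%N%:Z %| x)%Z = ((p ^ i)%N%:Z %| k%:Z)%Z by rewrite !dvdzE.
  rewrite -[x](subrK k%:Z) rpredDl //; apply: dvdz_trans v_xk.
  by rewrite dvdzE /= dvdn_exp2l.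
have k_gt0 : (0 < k)%N by case: k v_k {v_xk dvdE} => //; rewrite dvdn0.
have x_gt0 : (0 < `|x|)%N.
  by case: `|x|%N dvdE => // /(_ v (leqnn v)); rewrite dvdn0 (negPf v_k).
have lt_v n : (0 < n)%N -> ~~ (p ^ v %| n)%N -> (logn p n < v)%N.
  by move=> n_gt0; rewrite pfactor_dvdn // -ltnNge.
have ltk := lt_v _ k_gt0 v_k.
have ltx : (logn p `|x| < v)%N by apply: lt_v; rewrite ?dvdE.
apply/eqP; rewrite eqn_leq -!pfactor_dvdn // -dvdE; last exact: ltnW.
by rewrite pfactor_dvdnn dvdE ?pfactor_dvdnn // ltnW.
Qed.

(** * The product of [y - c] over the residues [c] outside [B] *)

Section AvoidingProduct.
Variables p v : nat.
Hypotheses (p_pr : prime p) (v_gt0 : (0 < v)%N).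

(* This is logn p ((p ^ v - 1)`!). *)
Definition avoid_exp := (\sum_(k : 'Z_(p ^ v) | k != 0%R) logn p k)%N.

Variables (B : {set 'Z_(p ^ v)}) (y : nat).
Hypothesis B_inc : incongruent p B.

Let m_gt1 : (1 < p ^ v)%N.
Proof. by rewrite -(exp1n v) ltn_exp2r ?prime_gt1. Qed.

Let dist (c : 'Z_(p ^ v)) := `|y%:Z - c%:Z|%N.
Let c0 : 'Z_(p ^ v) := y%:R.

Let dvd_dist k (c : 'Z_(p ^ v)) : (k %| dist c)%N = (y == c %[mod k]).
Proof. by rewrite -eqz_nat -!modz_nat eqz_mod_dvd dvdzE. Qed.

Let pv_dist c : (p ^ v %| dist c)%N = (c == c0).
Proof.
rewrite dvd_dist -val_eqE /= /c0 val_Zp_nat // eq_sym modn_small //.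
by rewrite -[X in (_ < X)%N]Zp_cast.
Qed.

Let dist_gt0 c : c != c0 -> (0 < dist c)%N.
Proof. by rewrite -pv_dist lt0n; apply: contraNneq => ->; rewrite dvdn0. Qed.

(** Modulo [p ^ v], the differences [y - c] with [c != c0] run through the nonzero residues, whose
    valuations do not depend on the representative. *)
Let sum_logn_dist : (\sum_(c | c != c0) logn p (dist c) = avoid_exp)%N.
Proof.
rewrite /avoid_exp (reindex_onto (fun k => c0 - k) (fun c => c0 - c)) /=.
  have predE k : (c0 - k != c0) && (c0 - (c0 - k) == k) = (k != 0).
    by rewrite subKr eqxx andbT -subr_eq0 addrAC subrr add0r oppr_eq0.
  apply: eq_big => [//|k]; rewrite predE => k0.
  apply: (@logn_eqmod _ v) => //.
    rewrite gtnNdvd // ?lt0n // -[X in (_ < X)%N]Zp_cast //.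
  rewrite -addrA -opprD -PoszD -eqz_mod_dvd !modz_nat eqz_nat -!val_Zp_nat //.
  by rewrite natrD !natr_Zp subrK.
by move=> c _; rewrite subKr.
Qed.

(** At most one term is nonzero, since at most one element of [B] is congruent to [y] modulo [p];
    that term is below [v] because [p ^ v] divides [dist c] only for [c = c0]. *)
Let sum_logn_distB : (\sum_(c in B | c != c0) logn p (dist c) < v)%N.
Proof.
case: (pickP (fun b => [&& b \in B, b != c0 & p %| dist b]%N)) => [b /and3P[bB bc0 pb]|no].
  rewrite (bigD1 b) ?bB //= big1 ?addn0.
    by rewrite ltnNge -pfactor_dvdn ?dist_gt0 // pv_dist.
  move=> c /andP[/andP[cB _] cb]; apply/eqP; rewrite lognE.
  case: ifP => // /and3P[_ _]; rewrite dvd_dist => pc; case/eqP: cb.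
  by apply: B_inc => //; rewrite -(eqP pc); apply/eqP; rewrite -dvd_dist.
rewrite big1 // => c /andP[cB cc0]; apply/eqP; rewrite lognE.
by case: ifP => // /and3P[_ _ pc]; have := no c; rewrite cB cc0 pc.
Qed.

Let split_exp : (avoid_exp = \sum_(c in B | c != c0) logn p (dist c) +
   logn p (\prod_(c | (c \notin B) && (c != c0)) dist c))%N.
Proof.
rewrite logn_prod => [|c /andP[_]]; last exact: dist_gt0.
rewrite -sum_logn_dist (bigID (mem B)) /=.
by congr (_ + _)%N; apply: eq_bigl => c; rewrite andbC.
Qed.

(** If [c0] is in [B], the other elements of [B] contribute valuation 0, so leaving them out keeps
    the valuation at exactly [avoid_exp]. If not, leaving out [B] loses less than [v], while the
    factor at [c0] brings at least [v]. That factor may be 0, hence the formulation by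
    divisibility. *)
Lemma dvdz_avoiding_prod :
  let f := \prod_(c : 'Z_(p ^ v) | c \notin B) (y%:Z - c%:Z) in
  ((p ^ avoid_exp)%N%:Z %| f)%Z /\
  ((p ^ avoid_exp.+1)%N%:Z %| f)%Z = (y%:R \notin B).
Proof.
move=> f; rewrite !dvdzE /= /f (big_morph absz abszM absz1) -/c0.
have P_gt0 : (0 < \prod_(c | (c \notin B) && (c != c0)) dist c)%N.
  by apply: prodn_cond_gt0 => c /andP[_]; apply: dist_gt0.
have [c0B|c0B] /= := boolP (c0 \in B).
  have logP : logn p (\prod_(c | (c \notin B) && (c != c0)) dist c) = avoid_exp.
    rewrite split_exp [X in (X + _)%N]big1 // => c /andP[cB cc0]; apply/eqP; rewrite lognE.
    case: ifP => // /and3P[_ _]; rewrite dvd_dist => pc; case/eqP: cc0.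
    apply: B_inc => //; rewrite -(eqP pc) /c0 val_Zp_nat // modn_dvdm //.
    exact: dvdn_exp.
  have -> : (\prod_(c | c \notin B) dist c =
             \prod_(c | (c \notin B) && (c != c0)) dist c)%N.
    apply: eq_bigl => c; case: eqP => [->|]; rewrite ?andbT //.
    by rewrite c0B.
  by rewrite !pfactor_dvdn // logP leqnn ltnn.
rewrite (bigD1 c0) //= -!/(dist _).
have le_e : (avoid_exp < v + logn p (\prod_(c | (c \notin B) && (c != c0)) dist c))%N.
  by rewrite split_exp ltn_add2r.
have dvd_e : (p ^ avoid_exp.+1 %| dist c0 * \prod_(c | (c \notin B) && (c != c0)) dist c)%N.
  apply: dvdn_trans (dvdn_exp2l p le_e) _; rewrite expnD dvdn_mul ?pv_dist //.
  exact: pfactor_dvdnn.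
by rewrite dvd_e; split=> //; apply: dvdn_trans dvd_e; apply: dvdn_exp2l.
Qed.
End AvoidingProduct.

(** * A p-adic Alon-Furedi bound *)

Section AlonFuredi.
Variables (I T : finType) (w : T -> int).
Implicit Types (a x : {ffun I -> T}) (S : I -> {set T}).
Implicit Types F G H : {ffun I -> T} -> int.

Definition upd {U : Type} (a : I -> U) (i : I) (z : U) (j : I) : U :=
  if j == i then z else a j.
Definition fupd a i z : {ffun I -> T} := [ffun j => upd a i z j].

(* This class contains the restrictions along w of the integer polynomials of
   total degree at most d: for those, the difference is divisible by
   x_i - z. *)
Fixpoint deg_le (d : nat) F : Prop :=
  if d is d'.+1 then
    forall i z, exists2 H, deg_le d' H &
      forall a, F a - F (fupd a i z) = (w (a i) - w z) * H a
  else forall a x, F a = F x.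

Lemma fupd_at a i z : fupd a i z i = z.
Proof. by rewrite ffunE /upd eqxx. Qed.

Lemma deg_le0 d : deg_le d (fun=> 0).
Proof. by elim: d => //= d IHd i z; exists (fun=> 0) => // a; rewrite mulr0. Qed.

Lemma deg_leD d F G : deg_le d F -> deg_le d G -> deg_le d (fun a => F a + G a).
Proof.
elim: d F G => [|d IHd] F G /= dF dG; first by move=> a x; rewrite (dF a x) (dG a x).
move=> i z; have [HF dHF EF] := dF i z; have [HG dHG EG] := dG i z.
exists (fun a => HF a + HG a) => [|a]; first exact: IHd.
by rewrite mulrDr -EF -EG; ring.
Qed.

Lemma deg_leMr d F c : deg_le d F -> deg_le d (fun a => F a * c).
Proof.
elim: d F => [|d IHd] F /= dF; first by move=> a x; rewrite (dF a x).
move=> i z; have [H dH E] := dF i z.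
by exists (fun a => H a * c) => [|a]; [exact: IHd | rewrite -mulrBl E mulrA].
Qed.

Lemma deg_le_fupd d F i z : deg_le d F -> deg_le d (fun a => F (fupd a i z)).
Proof.
elim: d F => [|d IHd] F /= dF; first by move=> a x; apply: dF.
move=> j t; case: (eqVneq j i) => [->|ji].
  (* After the substitution the function no longer depends on coordinate [i]. *)
  exists (fun=> 0) => [|a]; first exact: deg_le0.
  rewrite mulr0; apply/eqP; rewrite subr_eq0; apply/eqP; congr F.
  by apply/ffunP=> k; rewrite !ffunE /upd ffunE /upd; case: eqP.
have [H dH E] := dF j t; exists (fun a => H (fupd a i z)) => [|a]; first exact: IHd.
have -> : a j = fupd a i z j by rewrite ffunE /upd (negPf ji).
rewrite -E; congr (_ - F _); apply/ffunP=> k; rewrite !ffunE /upd !ffunE /upd.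
by case: (eqVneq k i) => // ->; rewrite eq_sym (negPf ji).
Qed.

(** Discrete Leibniz rule: with primes for the values after substituting [z],
    [F L - F' L' = (F - F') L + F' (L - L')], and [L - L'] is [w (a i) - w z] times the constant
    [g i]. *)
Lemma deg_leM_affine d F (g : I -> int) (c : int) : deg_le d F ->
  deg_le d.+1 (fun a => F a * (\sum_i w (a i) * g i - c)).
Proof.
have diffL a i z : \sum_j w (a j) * g j - \sum_j w (fupd a i z j) * g j =
    (w (a i) - w z) * g i.
  rewrite (bigD1 i) //= [X in _ - X](bigD1 i) //= fupd_at.
  rewrite (eq_bigr (fun j => w (fupd a i z j) * g j)); first by ring.
  by move=> j ji; rewrite ffunE /upd (negPf ji).
elim: d F => [|d IHd] F dF i z.
  exists (fun a => F a * g i) => [a x /=|a]; first by rewrite (dF a x).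
  rewrite (dF (fupd a i z) a) -mulrBr.
  rewrite [X in _ * X = _](_ : _ = (w (a i) - w z) * g i); first by ring.
  by rewrite -diffL; ring.
have [H dH E] := dF i z.
exists (fun a => H a * (\sum_i w (a i) * g i - c) + F (fupd a i z) * g i) => [|a].
  apply: (deg_leD d.+1); first exact: IHd.
  exact/deg_leMr/deg_le_fupd.
rewrite (_ : _ - _ = (F a - F (fupd a i z)) * (\sum_j w (a j) * g j - c)
  + F (fupd a i z) * (\sum_j w (a j) * g j - \sum_j w (fupd a i z j) * g j)).
  by rewrite E diffL; ring.
ring.
Qed.

Lemma eq_deg_le d F G : F =1 G -> deg_le d F -> deg_le d G.
Proof.
move=> FG; case: d => [|d] /= dF; first by move=> a x; rewrite -!FG.
by move=> i z; have [H dH E] := dF i z; exists H => // a; rewrite -!FG.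
Qed.

Lemma deg_leM_prod_affine (J : Type) (s : seq J) (g : I -> int) (c : J -> int) d F :
    deg_le d F ->
  deg_le (size s + d) (fun a => F a * \prod_(j <- s) (\sum_i w (a i) * g i - c j)).
Proof.
move=> dF; elim: s => [|j s IHs].
  by apply: eq_deg_le dF => a; rewrite big_nil mulr1.
apply: eq_deg_le (deg_leM_affine _ _ g (c j) IHs) => a.
by rewrite big_cons -mulrA (mulrC (\prod_(_ <- s) _)).
Qed.

Lemma deg_le_prod2_affine (J : Type) (K : J -> Type) (js : seq J)
    (s : forall j, seq (K j)) (g : J -> I -> int) (c : forall j, K j -> int) :
  deg_le (\sum_(j <- js) size (s j))%N (fun a : {ffun I -> T} =>
    \prod_(j <- js) \prod_(k <- s j) (\sum_i w (a i) * g j i - c j k)).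
Proof.
elim: js => [|j js IHjs]; first by rewrite big_nil => a x; rewrite !big_nil.
rewrite big_cons; apply: eq_deg_le (deg_leM_prod_affine _ (s j) (g j) (c j) _ _ IHjs).
by move=> a; rewrite big_cons mulrC.
Qed.

Definition box S : {set {ffun I -> T}} := [set a : {ffun I -> T} | [forall i, a i \in S i]].

Lemma boxP S a : reflect (forall i, a i \in S i) (a \in box S).
Proof. by rewrite inE; apply: forallP. Qed.

Lemma box_upd S i (U : {set T}) a : U \subset S i ->
  (a \in box (upd S i U)) = (a \in box S) && (a i \in U).
Proof.
move=> US; apply/boxP/andP => [aS | [/boxP aS aU] j].
  have aU := aS i; rewrite /upd eqxx in aU; split=> //; apply/boxP=> j.
  by have := aS j; rewrite /upd; case: eqP => // ->; apply: subsetP.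
by rewrite /upd; case: eqP => // ->.
Qed.

Lemma fupd_box S i z a : a \in box S -> z \in S i -> fupd a i z \in box (upd S i [set z]).
Proof.
move=> /boxP aS zS; apply/boxP=> j; rewrite ffunE /upd.
by case: eqP => [_|_]; rewrite ?set11.
Qed.

Lemma sum_upd (f : I -> nat) i k : (\sum_j upd f i k j + f i = \sum_j f j + k)%N.
Proof.
rewrite (bigD1 i) //= [in RHS](bigD1 i) //= /upd eqxx.
rewrite (eq_bigr f) => [|j /negPf ->//]; lia.
Qed.

Lemma card_upd S i (U : {set T}) j : #|upd S i U j| = upd (fun k => #|S k|) i #|U| j.
Proof. by rewrite /upd; case: eqP. Qed.

Variables (p e : nat).
Hypothesis p_pr : prime p.

(** When [p ^ e] divides every value of [F] on the box, these are the points where [F / p ^ e] is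
    nonzero modulo [p]. *)
Definition nonzeros S F := [set a in box S | ~~ ((p ^ e.+1)%N%:Z %| F a)%Z].

Lemma in_nonzeros S F a :
  (a \in nonzeros S F) = (a \in box S) && ~~ ((p ^ e.+1)%N%:Z %| F a)%Z.
Proof. exact: in_set. Qed.

(** Producing some [y] of large enough sum, rather than bounding by a minimum, lets the induction on
    the total size of the [S i] modify [y] directly. *)
Lemma alon_furedi_padic S d F :
    (forall i s t, s \in S i -> t \in S i -> s != t -> ~~ (p%:Z %| w s - w t)%Z) ->
    deg_le d F ->
    (forall a, a \in box S -> ((p ^ e)%N%:Z %| F a)%Z) ->
    nonzeros S F != set0 ->
  exists y : I -> nat,
    [/\ forall i, (0 < y i <= #|S i|)%N,
        (\sum_i #|S i| <= \sum_i y i + d)%N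
      & (\prod_i y i <= #|nonzeros S F|)%N].
Proof.
have [m] := ubnP (\sum_i #|S i|)%N.
elim: m S d F => // m IHm S d F; rewrite ltnS => S_le S_inc dF F_int F_n0.
have S_gt0 i : (0 < #|S i|)%N.
  have /set0Pn[a] := F_n0; rewrite inE => /andP[/boxP aS _].
  by apply/card_gt0P; exists (a i).
(* If all sides are singletons, [y = 1] works, as there is a nonzero. *)
have [/existsP[i S_gt1]|] := boolP [exists i, (1 < #|S i|)%N]; last first.
  rewrite negb_exists => /forallP S_le1; exists (fun=> 1%N); split=> [i|| ].
  - by rewrite S_gt0.
  - apply: leq_trans (leq_addr _ _); apply: leq_sum => i _.
    by rewrite leqNgt S_le1.
  - by rewrite big1 // card_gt0.
have subS (U : {set T}) : U \subset S i -> forall j s t,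
    s \in upd S i U j -> t \in upd S i U j -> s != t -> ~~ (p%:Z %| w s - w t)%Z.
  move=> US j s t; rewrite /upd; case: eqP => _ sU tU.
    by apply: (S_inc i); apply: (subsetP US).
  exact: (S_inc j).
have sumS (U : {set T}) :
    (\sum_j #|upd S i U j| + #|S i| = \sum_j #|S j| + #|U|)%N.
  by under eq_bigr do rewrite card_upd; rewrite sum_upd.
(* If F vanishes on the fibre over some z in S i, divide F by x_i - z and
   remove z from S i: both d and \sum_i #|S i| drop by one.  Otherwise every
   fibre contains nonzeros, and the fibre with the fewest yields y. *)
have [/exists_inP[z zS /eqP Fz0]|] :=
    boolP [exists z in S i, nonzeros (upd S i [set z]) F == set0].
  have p_F a : a \in box S -> ((p ^ e.+1)%N%:Z %| F (fupd a i z))%Z.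
    move=> aS; have := in_set0 (fupd a i z).
    by rewrite -Fz0 inE (fupd_box _ _ _ _ aS zS) => /negbFE.
  have UsubS : S i :\ z \subset S i by rewrite subD1set.
  have cU : #|S i| = #|S i :\ z|.+1 by rewrite (cardsD1 z) zS.
  (* For [d = 0], [F] is constant and vanishing on one fibre contradicts [F_n0]. *)
  case: d dF => [|d] dF.
    have /set0Pn[a] := F_n0; rewrite inE => /andP[aS].
    by rewrite (dF a (fupd a i z)) p_F.
  have [H dH E] := dF i z.
  (* [w (a i) - w z] is prime to [p], and [F] at the substituted point is divisible by [p ^ e.+1],
     so it cannot affect divisibility by [p ^ k]. *)
  have dvdH k a : a \in box (upd S i (S i :\ z)) -> (k <= e.+1)%N ->
      ((p ^ k)%N%:Z %| H a)%Z = ((p ^ k)%N%:Z %| F a)%Z.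
    rewrite box_upd // => /andP[aS]; rewrite in_setD1 => /andP[az aSi] ke.
    rewrite -(@Gauss_dvdzr _ (w (a i) - w z)) -?E.
      rewrite rpredBr //; apply: dvdz_trans (p_F a aS).
      by rewrite dvdzE /= dvdn_exp2l.
    rewrite coprimezE /= coprimeXl // prime_coprime //.
    by have := S_inc i _ _ aSi zS az; rewrite dvdzE.
  have nzE : nonzeros (upd S i (S i :\ z)) H = nonzeros S F.
    apply/setP=> a; rewrite !in_nonzeros.
    apply/andP/andP=> [[aS' nzH]|[aS nzF]].
      split; first by move: aS'; rewrite box_upd // => /andP[].
      by rewrite -(dvdH _ _ aS').
    suff aS' : a \in box (upd S i (S i :\ z)) by rewrite aS' (dvdH _ _ aS').
    rewrite box_upd // aS in_setD1; have /boxP/(_ i)-> := aS; rewrite andbT.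
    apply: contraNneq nzF => aiz; suff <- : fupd a i z = a by apply: p_F.
    by apply/ffunP=> j; rewrite ffunE /upd; case: eqP => // ->.
  have [|||||y [y_bd y_sum y_prod]] := IHm (upd S i (S i :\ z)) d H.
  - by have := sumS (S i :\ z); lia.
  - exact: subS.
  - exact: dH.
  - move=> a aS; rewrite dvdH //; apply: F_int.
    by move: aS; rewrite box_upd // => /andP[].
  - by rewrite nzE.
  exists y; split; last by rewrite -nzE.
    by move=> j; have := y_bd j; rewrite card_upd /upd; case: eqP => // ->; lia.
  by have := sumS (S i :\ z); lia.
rewrite negb_exists_in => /forall_inP nz_fib.
have /card_gt0P[s0 s0S] := S_gt0 i.
case: (@arg_minnP _ s0 (mem (S i)) (fun s => #|nonzeros (upd S i [set s]) F|) s0S).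
move=> s sS s_min; have sub1 t : t \in S i -> [set t] \subset S i by rewrite sub1set.
have [|||||y [y_bd y_sum y_prod]] := IHm (upd S i [set s]) d F.
- by have := sumS [set s]; rewrite cards1; lia.
- exact/subS/sub1.
- exact: dF.
- by move=> a; rewrite box_upd ?sub1 // => /andP[aS _]; apply: F_int.
- exact: nz_fib.
have yi1 : y i = 1%N by have := y_bd i; rewrite card_upd /upd eqxx cards1; lia.
(* Each of the [#|S i|] fibres has at least as many nonzeros as the minimal one, so the entry 1 at
   [i] may be replaced by [#|S i|]. *)
exists (upd y i #|S i|); split.
- move=> j; have := y_bd j; rewrite card_upd /upd; case: eqP => [->|//].
  by rewrite S_gt0 leqnn.
- by have := sumS [set s]; have := sum_upd y i #|S i|; rewrite cards1 yi1; lia.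
have -> : (\prod_j upd y i #|S i| j = #|S i| * \prod_j y j)%N.
  rewrite (bigD1 i) //= [in RHS](bigD1 i) //= yi1 mul1n {1}/upd eqxx.
  by congr muln; apply: eq_bigr => j /negPf ji; rewrite /upd ji.
have -> : #|nonzeros S F| = (\sum_(t in S i) #|nonzeros (upd S i [set t]) F|)%N.
  rewrite -sum1_card (partition_big (fun a : {ffun I -> T} => a i) (mem (S i))) /=.
    apply: eq_bigr => t tS; rewrite sum1dep_card; apply: eq_card => a.
    by rewrite inE !in_nonzeros box_upd ?sub1 // in_set1 andbAC.
  by move=> a; rewrite inE => /andP[/boxP].
rewrite -sum_nat_const; apply: leq_sum => t tS.
exact: leq_trans y_prod (s_min t tS).
Qed.
End AlonFuredi.

(** * Solutions as nonzeros of an integer polynomial *)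

Lemma dsum_sumE (p r : nat) (v : 'I_r -> nat) (I : finType) (f : I -> dsum p v) j :
  (\sum_i f i) j = \sum_i f i j.
Proof. by apply: (big_morph (fun x : dsum p v => x j)) => [x y|]; rewrite ffunE. Qed.

(** Serves both parts of the theorem: for (a) [y] is lowered to the prescribed sum, for (b) its
    product exceeds 1. *)
Lemma solutions_lower_bound (p : nat) (p_pr : prime p) (r w n : nat) (v : 'I_r -> nat)
    (v_gt0 : forall j, (0 < v j)%N) (A : 'I_n -> {set 'Z_w})
    (B : forall j : 'I_r, {set 'Z_(p ^ v j)})
    (A_inc : forall i, incongruent p (A i)) (B_inc : forall j, incongruent p (B j))
    (g : 'I_n -> dsum p v) :
  let sols := [set a : {ffun 'I_n -> 'Z_w} | [forall i : 'I_n, a i \in A i]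
        && (\sum_(i < n) dscale (a i) (g i) \in dbox B)] in
  sols != set0 ->
  exists y : 'I_n -> nat,
    [/\ forall i, (0 < y i <= #|A i|)%N,
        (\sum_i #|A i| <= \sum_i y i + \sum_j (p ^ v j - #|B j|))%N
      & (\prod_i y i <= #|sols|)%N].
Proof.
move=> sols; pose s j := enum (~: B j).
(* [Y a j] is a natural number representing coordinate [j] of the sum. *)
pose Y (a : {ffun 'I_n -> 'Z_w}) j := (\sum_i (a i : nat) * (g i j : nat))%N.
pose F (a : {ffun 'I_n -> 'Z_w}) := \prod_j \prod_(c <- s j)
  (\sum_i (a i : nat)%:Z * (g i j : nat)%:Z - (c : nat)%:Z).
pose e := (\sum_j avoid_exp p (v j))%N.
have pv_gt1 j : (1 < p ^ v j)%N by rewrite -(exp1n (v j)) ltn_exp2r ?prime_gt1.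
have FE a : F a = \prod_j \prod_(c : 'Z_(p ^ v j) | c \notin B j)
    ((Y a j)%:Z - (c : nat)%:Z).
  apply: eq_bigr => j _; rewrite big_enum_cond /=.
  apply: eq_big => [c|c _]; first by rewrite in_setC andbT.
  by rewrite /Y (big_morph Posz PoszD (erefl _)).
have YE (a : {ffun 'I_n -> 'Z_w}) j : (\sum_i dscale (a i) (g i)) j = (Y a j)%:R.
  rewrite dsum_sumE natr_sum; apply: eq_bigr => i _.
  by rewrite ffunE natrM natr_Zp.
have F_dvd (a : {ffun 'I_n -> 'Z_w}) : ((p ^ e)%N%:Z %| F a)%Z /\
    ((p ^ e.+1)%N%:Z %| F a)%Z = (\sum_i dscale (a i) (g i) \notin dbox B).
  rewrite FE; have fP j := @dvdz_avoiding_prod p (v j) p_pr (v_gt0 j) (B j) (Y a j) (B_inc j).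
  have [-> ->] := @dvdz_prod_pfactor p _ _ (fun j => avoid_exp p (v j)) p_pr (fun j => (fP j).1).
  split=> //; rewrite inE negb_forall; apply: eq_existsb => j.
  by have [_ ->] := fP j; rewrite YE.
have solsE : sols = nonzeros _ _ p e A F.
  apply/setP=> a; rewrite in_nonzeros (F_dvd a).2 negbK in_set.
  by congr (_ && _); rewrite in_set.
have cardZ j : #|{: 'Z_(p ^ v j)}| = (p ^ v j)%N by rewrite card_ord Zp_cast.
have dE : (\sum_j (p ^ v j - #|B j|) = \sum_j size (s j))%N.
  by apply: eq_bigr => j _; rewrite -cardE [RHS]cardsCs setCK cardZ.
rewrite dE solsE; apply: (@alon_furedi_padic _ _ (fun c : 'Z_w => (c : nat)%:Z)) => //.
  move=> i x y xA yA; apply: contraNN; rewrite -eqz_mod_dvd !modz_nat eqz_nat.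
  by move=> /eqP xy; apply/eqP; apply: (A_inc i).
  exact: (@deg_le_prod2_affine _ _ (fun c : 'Z_w => (c : nat)%:Z)).
by move=> a _; have [] := F_dvd a.
Qed.

(** * Positive vectors with prescribed sum, and the theorem *)

Lemma exists_gt1_of_sum {n : nat} {y : 'I_n -> nat} :
  (n < \sum_i y i)%N -> exists i, (1 < y i)%N.
Proof.
move=> n_lt; apply/existsP; apply: contraLR n_lt => /existsPn y_le1.
rewrite -leqNgt -[leqRHS]card_ord -sum1_card; apply: leq_sum => i _.
by rewrite leqNgt y_le1.
Qed.

(** As long as the sum exceeds [N >= n], some entry exceeds 1 and can be lowered by one. *)
Lemma exists_sum_between (n N : nat) (y : 'I_n -> nat) :
    (forall i, 0 < y i)%N -> (n <= N <= \sum_i y i)%N ->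
  exists z : 'I_n -> nat, (forall i, 0 < z i <= y i)%N /\ (\sum_i z i = N)%N.
Proof.
have [m] := ubnP (\sum_i y i)%N; elim: m y => // m IHm y.
rewrite ltnS => y_le y_gt0 /andP[nN]; rewrite leq_eqVlt => /orP[/eqP->|N_lt].
  by exists y; split=> // i; rewrite y_gt0 leqnn.
have [i yi_gt1] := exists_gt1_of_sum (leq_ltn_trans nN N_lt).
have sum_y := sum_upd _ y i (y i).-1.
have [|j||z [z_bd z_sum]] := IHm (upd _ y i (y i).-1); first by lia.
- by rewrite /upd; case: eqP => // _; lia.
- by lia.
exists z; split=> // j; have := z_bd j; rewrite /upd.
by case: eqP => // ->; lia.
Qed.

Theorem theorem3p8
  (p : nat) (p_pr : prime p)
  (r : nat) (v : 'I_r.+1 -> nat)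
  (v_ge1 : forall j, (1 <= v j)%N)
  (v_mono : forall j k : 'I_r.+1, (j <= k)%N -> (v j <= v k)%N)
  (A : nat -> {set 'Z_(p ^ v ord_max)})
  (B : forall j : 'I_r.+1, {set 'Z_(p ^ v j)})
  (A_neq0 : forall i, A i != set0)
  (A_inc : forall i, incongruent p (A i))
  (B_neq0 : forall j, B j != set0)
  (B_inc : forall j, incongruent p (B j))
  (n : nat) (n_gt0 : (0 < n)%N)
  (g : 'I_n -> dsum p v) :
  (let sols := [set a : {ffun 'I_n -> 'Z_(p ^ v ord_max)} |
        [forall i : 'I_n, a i \in A i]
        && (\sum_(i < n) dscale (a i) (g i) \in dbox B)] in
   #|sols| = 0%N \/
   (min_prod (fun i : 'I_n => #|A i|)
      (\sum_(i < n) #|A i|%:Z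
       - \sum_(j < r.+1) ((p ^ v j)%N%:Z - #|B j|%:Z)) <= #|sols|)%N)
  /\
  ((forall i, 0 \in A i) -> (forall j, 0 \in B j) ->
   \sum_(j < r.+1) ((p ^ v j)%N%:Z - #|B j|%:Z)
     < \sum_(i < n) (#|A i|%:Z - 1) ->
   exists a : {ffun 'I_n -> 'Z_(p ^ v ord_max)},
     [/\ forall i : 'I_n, a i \in A i,
         exists i : 'I_n, a i != 0
       & \sum_(i < n) dscale (a i) (g i) \in dbox B]).
Proof.
have sumA : \sum_(i < n) #|A i|%:Z = (\sum_(i < n) #|A i|)%N%:Z.
  by rewrite (big_morph Posz PoszD (erefl _)).
have sumB : \sum_(j < r.+1) ((p ^ v j)%N%:Z - #|B j|%:Z) =
    (\sum_(j < r.+1) (p ^ v j - #|B j|))%N%:Z.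
  rewrite (big_morph Posz PoszD (erefl _)); apply: eq_bigr => j _.
  rewrite subzn //; apply: leq_trans (max_card _) _.
  by rewrite card_ord Zp_cast // -(exp1n (v j)) ltn_exp2r ?prime_gt1.
have bound := @solutions_lower_bound p p_pr _ _ n v v_ge1 (fun i => A i) B
  (fun i => A_inc i) B_inc g.
rewrite sumA sumB; set D := (\sum_(j < r.+1) _)%N in bound *.
split=> [sols|A0 B0 D_lt].
  have [->|/bound[y [y_bd y_sum y_prod]]] := eqVneq sols set0.
    by left; rewrite cards0.
  right; have y_gt0 i : (0 < y i)%N by have /andP[] := y_bd i.
  (* Below [n] the value of [min_prod] is 1. Otherwise lowering [y] to sum [N] gives a vector
     admissible for the minimum, with no larger product. *)
  apply: leq_trans y_prod; case: (ltrP ((\sum_(i < n) #|A i|)%N%:Z - D%:Z) n%:Z) => [lt_n|n_le].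
    by rewrite /min_prod lt_n prodn_gt0.
  have [|z [z_bd z_sum]] := @exists_sum_between n (\sum_(i < n) #|A i| - D) y y_gt0.
    by move: y_sum n_le => /=; lia.
  have -> : (\sum_(i < n) #|A i|)%N%:Z - D%:Z = (\sum_i z i)%N%:Z by lia.
  apply: leq_trans (min_prod_le _) _ => [i|].
    by have := z_bd i; have := y_bd i; lia.
  by apply: leq_prod => i _; have /andP[] := z_bd i.
have [|y [y_bd y_sum y_prod]] := bound.
  (* The zero tuple is a solution, so the bound applies. *)
  apply/set0Pn; exists [ffun=> 0]; rewrite !inE; apply/andP; split.
    by apply/forallP=> i; rewrite ffunE.
  apply/forallP=> j; rewrite dsum_sumE big1 ?B0 // => i _.
  by rewrite !ffunE mul0r.
have [|i yi_gt1] := @exists_gt1_of_sum n y.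
  by move: D_lt y_sum; rewrite sumrB sumA sumr_const card_ord natz /=; lia.
have y_gt1 : (1 < \prod_i y i)%N.
  rewrite (bigD1 i) //=; apply: leq_trans yi_gt1 (leq_pmulr _ _).
  by apply: prodn_gt0 => k; have /andP[] := y_bd k.
(* There are two distinct solutions, so one of them is nonzero. *)
have /card_gt1P[a [b [aS bS ab]]] := leq_trans y_gt1 y_prod.
have [c] : exists2 c, c != [ffun=> 0] & c \in [set a : {ffun 'I_n -> 'Z_(p ^ v ord_max)} |
    [forall i : 'I_n, a i \in A i] && (\sum_(i < n) dscale (a i) (g i) \in dbox B)].
  by have [a0|] := eqVneq a [ffun=> 0]; [exists b; rewrite // -a0 eq_sym | exists a].
move=> c0; rewrite inE => /andP[/forallP cA cB]; exists c; split=> //.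
apply/existsP; apply: contraNT c0 => /existsPn c0.
by apply/eqP/ffunP=> k; rewrite ffunE; apply/eqP; rewrite -[_ == _]negbK c0.
Qed.
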